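(* A function $f:\mathbb{Z}\to\mathbb{Z}$ is $\langle\mathbb{Z};+\rangle$-congruence preserving if and only if for every recognizable subset $L$ of $\langle\mathbb{Z};+\rangle$ the lattice $\mathcal{L}_{\langle\mathbb{Z};+\rangle}(L)$ is closed under $f^{-1}$ (i.e. $f^{-1}(Z)\in\mathcal{L}_{\langle\mathbb{Z};+\rangle}(L)$ for all $Z\in\mathcal{L}_{\langle\mathbb{Z};+\rangle}(L)$).
   Context: A congruence on $\langle\mathbb{Z};+\rangle$ is an equivalence relation compatible with $+$; $f$ is congruence preserving if $x\sim y\Rightarrow f(x)\sim f(y)$ for every such congruence. $L\subseteq\mathbb{Z}$ is recognizable if $L=\varphi^{-1}(\varphi(L))$ for some surjective morphism $\varphi$ from $\langle\mathbb{Z};+\rangle$ onto a finite algebra with one binary operation. $\mathcal{L}_{\langle\mathbb{Z};+\rangle}(L)$ is the smallest family of subsets of $\mathbb{Z}$ containing $L$, closed under binary union and intersection, and containing $\{x\mid x+a\in Z\}$ whenever it contains $Z$, for every $a\in\mathbb{Z}$. *)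

(* Defs.v *)
From mathcomp Require Import all_boot all_order all_algebra.
From mathcomp Require Import boolp classical_sets functions.
From Stdlib Require Import RelationClasses.

Set Implicit Arguments.
Unset Strict Implicit.
Unset Printing Implicit Defensive.

Import GRing.Theory.
Local Open Scope classical_set_scope.
Local Open Scope ring_scope.

Definition congruence (R : int -> int -> Prop) : Prop :=
  Equivalence R /\
  forall x y x' y' : int, R x y -> R x' y' -> R (x + x') (y + y').

Definition congruence_preserving (f : int -> int) : Prop :=
  forall R : int -> int -> Prop, congruence R ->
    forall x y : int, R x y -> R (f x) (f y).

(* No law is imposed on the operation of the finite algebra. *)
Definition recognizable (L : set int) : Prop :=
  exists (M : finType) (op : M -> M -> M) (phi : int -> M),
    [/\ {morph phi : x y / x + y >-> op x y},
        set_surj [set: int] [set: M] phi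
      & L = phi @^-1` (phi @` L)].

(* Only binary unions and intersections: set0 and setT are not required to
   belong to the family. *)
Definition translation_lattice (F : set (set int)) : Prop :=
  [/\ forall Y Z : set int, F Y -> F Z -> F (Y `|` Z),
      forall Y Z : set int, F Y -> F Z -> F (Y `&` Z)
    & forall (a : int) (Z : set int), F Z -> F [set x | Z (x + a)]].

Definition generated_lattice (L : set int) : set (set int) :=
  smallest translation_lattice [set L].

(* Main.v *)
Require Import Defs.
From mathcomp Require Import all_boot all_order all_algebra.
From mathcomp Require Import boolp classical_sets functions.
From mathcomp Require Import ring zify.

Set Implicit Arguments.
Unset Strict Implicit.
Unset Printing Implicit Defensive.

Import GRing.Theory.
Local Open Scope classical_set_scope.

(** Every recognizable [L] has only finitely many translates, and
    [u ~ v := forall t, u + t \in L <-> v + t \in L] is a congruence.  The class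
    of [u] is the intersection of the translates of [L] containing [u]: if
    [L - u] is included in [L - v] then, the sets being periodic, they are
    equal.  A congruence preserving [f] makes [f^-1(L)] a finite union of such
    classes.  Conversely, a nontrivial congruence has recognizable classes, and
    the lattice generated by the class of [f x] consists of saturated sets, so
    the inverse image of this class contains [y] as soon as [x ~ y]. *)

Lemma generated_lattice_gen (L : set int) : generated_lattice L L.
Proof. by move=> F [_]; apply. Qed.

Lemma generated_lattice_translation (L : set int) :
  translation_lattice (generated_lattice L).
Proof.
split.
- by move=> Y Z HY HZ F HF; have [[HU _ _] _] := HF; exact: HU (HY F HF) (HZ F HF).
- by move=> Y Z HY HZ F HF; have [[_ HI _] _] := HF; exact: HI (HY F HF) (HZ F HF).
- by move=> a Z HZ F HF; have [[_ _ HT] _] := HF; exact: HT (HZ F HF).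
Qed.

Lemma generated_lattice_ind (L : set int) (P : set (set int)) :
  translation_lattice P -> P L -> generated_lattice L `<=` P.
Proof. by move=> HP PL Z; apply; split=> // _ ->. Qed.

Section FiniteOperations.
Context (F : set (set int)) (latF : translation_lattice F).
Context (I : finType) (P : set I) (A : I -> set int).
Hypothesis FA : forall i, P i -> F (A i).

(** A member [Y] of [F] starts the union, because [P] may be empty and [F] need not contain [set0];
    dually for the intersection below. *)
Lemma translation_latticeUbigcup (Y : set int) :
  F Y -> F (Y `|` \bigcup_(i in P) A i).
Proof.
move=> FY; have [FU _ _] := latF.
have -> : \bigcup_(i in P) A i = \big[setU/set0]_(i <- enum I | `[< P i >]) A i.
  rewrite -bigcup_seq_cond; apply: eq_bigcupl.
  by split=> i /=; rewrite mem_enum => /asboolP.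
elim: (enum I) => [|i s IHs]; first by rewrite big_nil setU0.
rewrite big_cons; case: asboolP => [Pi|//].
by rewrite setUCA; apply: FU => //; apply: FA.
Qed.

Lemma translation_latticeIbigcap (Y : set int) :
  F Y -> F (Y `&` \bigcap_(i in P) A i).
Proof.
move=> FY; have [_ FI _] := latF.
have -> : \bigcap_(i in P) A i = \big[setI/setT]_(i <- enum I | `[< P i >]) A i.
  rewrite -bigcap_seq_cond; apply: eq_bigcapl.
  by split=> i /=; rewrite mem_enum => /asboolP.
elim: (enum I) => [|i s IHs]; first by rewrite big_nil setIT.
rewrite big_cons; case: asboolP => [Pi|//].
by rewrite setICA; apply: FI => //; apply: FA.
Qed.

End FiniteOperations.

Local Open Scope ring_scope.

Definition syntactic_congruence (L : set int) (u v : int) : Prop :=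
  forall t : int, L (u + t) <-> L (v + t).

Lemma syntactic_congruenceP (L : set int) : congruence (syntactic_congruence L).
Proof.
split.
  split.
  - by move=> u t.
  - by move=> u v uv t; rewrite (uv t).
  - by move=> u v w uv vw t; rewrite (uv t).
move=> x y x' y' xy x'y' t.
by rewrite -addrA (xy _) addrCA (x'y' _) addrCA addrA.
Qed.

(** Since [L] is a union of fibres of [phi], adding [t] to two points of one fibre cannot separate
    them by [L]. Hence the translates of [L] by the finitely many [g k] are all its translates. *)
Lemma recognizable_representatives (L : set int) : recognizable L ->
  exists (M : finType) (phi : int -> M) (g : M -> int),
    (forall u v, phi u = phi v -> syntactic_congruence L u v) /\ cancel g phi.
Proof.
move=> [M [op [phi [phiD phi_surj ->]]]]; exists M, phi.
have /choice[g gK] : forall m, exists u, phi u = m.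
  by move=> m; have [u _ <-] := phi_surj m I; exists u.
by exists g; split=> // u v uv t; rewrite /preimage /= !phiD uv.
Qed.

(** Translation by [c = v - u] maps [L] into itself, and by the pigeonhole principle some positive
    multiple of [c] is a period of [L]. *)
Lemma recognizable_sub_translate (L : set int) (u v : int) :
  recognizable L -> (forall t, L (u + t) -> L (v + t)) ->
  syntactic_congruence L u v.
Proof.
move=> /recognizable_representatives[M [phi [_ [phiP _]]]] sub.
set c := v - u.
have step z : L z -> L (z + c).
  by move=> Lz; have := sub (z - u); rewrite addrC subrK addrCA => /(_ Lz).
have steps k z : L z -> L (z + c *+ k).
  elim: k => [|k IHk] Lz; first by rewrite mulr0n addr0.
  by rewrite mulrSr addrA; apply/step/IHk.
have [i [j [ltij eqij]]] : exists i j : nat, (i < j)%N /\ phi (c *+ i) = phi (c *+ j).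
  have /injectivePn[i [j neqij eqij]] : ~~ injectiveb (fun i : 'I_#|M|.+1 => phi (c *+ i)).
    by apply/negP => /injectiveP/leq_card; rewrite card_ord ltnn.
  have [ltij|ltji|/val_inj eq_ij] := ltngtP i j.
  - by exists i, j.
  - by exists j, i.
  - by rewrite eq_ij eqxx in neqij.
move=> t; split=> [|Lvt]; first exact: sub.
have /(phiP _ _)/(_ (u + t - c *+ i)) := eqij.
rewrite addrC subrK => ->.
(* Modulo the period [c *+ (j - i)], one step back from [v] to [u] amounts to [(j - i).-1] steps
   forward. *)
suff -> : c *+ j + (u + t - c *+ i) = v + t + c *+ (j - i).-1 by apply: steps.
have -> : j = (i + (j - i).-1.+1)%N by lia.
by rewrite mulrnDr mulrSr addKn /c; ring.
Qed.

Lemma generated_lattice_preimage (L : set int) (f : int -> int) :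
  recognizable L -> congruence_preserving f -> generated_lattice L (f @^-1` L).
Proof.
move=> recL fP.
have [M [phi [g [phiP gK]]]] := recognizable_representatives recL.
have latL := generated_lattice_translation L.
have genL := @generated_lattice_gen L.
have [_ _ transL] := latL.
have gphi u : syntactic_congruence L (g (phi u)) u by apply: phiP; rewrite gK.
(* An empty or full [L] is its own preimage. Otherwise the intersection and the union of all
   translates are [set0] and [setT], which serve as starting values below. *)
have [L0|/existsNP[y /contrapT Ly]] := pselect (forall y, ~ L y).
  suff -> : f @^-1` L = L by [].
  by apply/seteqP; split=> x /= /L0.
have [LT|/existsNP[z nLz]] := pselect (forall y, L y).
  suff -> : f @^-1` L = L by [].
  by apply/seteqP; split=> x /=.
have gen0 : generated_lattice L set0.
  suff <- : L `&` \bigcap_(k in [set: M]) [set x | L (x + g k)] = set0.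
    by apply: (translation_latticeIbigcap latL) => // k _; exact: (transL (g k) L).
  apply/seteqP; split=> // x [_ /(_ (phi (z - x)) I) /=].
  by rewrite addrC (gphi _ _) subrK => /nLz.
have genT : generated_lattice L setT.
  suff <- : L `|` \bigcup_(k in [set: M]) [set x | L (x + g k)] = setT.
    by apply: (translation_latticeUbigcup latL) => // k _; exact: (transL (g k) L).
  apply/seteqP; split=> // x _; right; exists (phi (y - x)) => //=.
  by rewrite addrC (gphi _ _) subrK.
have fsyn u v : syntactic_congruence L u v -> L (f u) -> L (f v).
  by move=> /(fP _ (syntactic_congruenceP L))/(_ 0); rewrite !addr0 => ->.
(* The inner intersection, over the translates of [L] containing [g m], is the syntactic class of
   [g m]. *)
suff -> : f @^-1` L = set0 `|` \bigcup_(m in [set m | L (f (g m))])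
    (setT `&` \bigcap_(k in [set k | L (g m + g k)]) [set x | L (x + g k)]).
  apply: (translation_latticeUbigcup latL) => // m _.
  by apply: (translation_latticeIbigcap latL) => // k _; exact: (transL (g k) L).
rewrite set0U; apply/seteqP; split=> x /=.
  move=> Lfx; exists (phi x) => /=.
    by apply: fsyn Lfx => t; rewrite (gphi _ _).
  by split=> // k /=; rewrite (gphi _ _).
move=> [m /= Lfgm [_ atom]]; apply: fsyn Lfgm.
(* Membership in the intersection gives only one inclusion, for the shifts [g k]; [gphi] extends it
   to every shift [t]. *)
apply: recognizable_sub_translate => // t.
rewrite addrC -(gphi t _) addrC => /(atom (phi t)) /=.
by rewrite addrC (gphi _ _) addrC.
Qed.

Lemma periodic_recognizable (L : set int) (n : nat) :
  (1 < n)%N -> (forall x k : int, L x -> L (x + n%:Z * k)) -> recognizable L.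
Proof.
move=> n_gt1 perL; exists 'Z_n, +%R, (fun z => z%:~R); split.
- by move=> x y; rewrite intrD.
- by move=> i _; exists (i : nat)%:Z => //=; rewrite -pmulrn natr_Zp.
- have intr0 (z : int) : z%:~R = 0 :> 'Z_n -> (n%:Z %| z)%Z.
    have natr0 k : k%:R = 0 :> 'Z_n -> (n %| k)%N.
      by move=> /(congr1 val); rewrite /= val_Zp_nat // => /eqP.
    case: z => k; first exact: natr0.
    by rewrite NegzE mulrNz => /eqP; rewrite oppr_eq0 => /eqP/natr0.
  apply/seteqP; split=> x /=; first by move=> Lx; exists x.
  move=> [y Ly /eqP]; rewrite eq_sym -subr_eq0 -rmorphB /= => /eqP/intr0/dvdzP[q xy].
  by rewrite -[x](subrK y) xy addrC mulrC; apply: perL.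
Qed.

(** The integers related to [0] form a subgroup containing [x - y], whose multiples are therefore
    periods of the class. If [R] is equality, the classes are singletons, which are not
    recognizable. *)
Lemma congruence_class_recognizable (R : int -> int -> Prop) (x y a : int) :
  congruence R -> R x y -> x <> y -> recognizable [set z | R z a].
Proof.
move=> [[Rrefl Rsym Rtrans] RD] Rxy neq_xy.
have R0 : R 0 (x - y).
  by rewrite -(subrr y); apply: RD; [apply: Rsym | apply: Rrefl].
have R0D u v : R 0 u -> R 0 v -> R 0 (u + v).
  by move=> /RD uP /uP; rewrite addr0.
have R0N u : R 0 u -> R 0 (- u).
  by move=> /RD/(_ (Rrefl (- u))); rewrite add0r subrr => /Rsym.
have R0Mn u k : R 0 u -> R 0 (u *+ k).
  move=> R0u; elim: k => [|k IHk]; first by rewrite mulr0n; apply: Rrefl.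
  by rewrite mulrS; apply: R0D.
have R0M u k : R 0 u -> R 0 (u * k).
  case: k => k R0u; first by rewrite -mulrzz; apply: R0Mn.
  by rewrite NegzE mulrN -mulrzz; apply/R0N/R0Mn.
(* The factor 2 keeps the modulus above 1, as required by ['Z_n]. *)
apply: (@periodic_recognizable _ (`|x - y| * 2)%N); first by lia.
move=> z k /= Rza.
have /(R0M _ k) R0k : R 0 (`|x - y| * 2)%N%:Z.
  have [->|->] : (`|x - y| * 2)%N%:Z = (x - y) * 2 \/
      (`|x - y| * 2)%N%:Z = (x - y) * (- 2) by lia.
  - exact: R0M.
  - exact: R0M.
by rewrite -[a]addr0; apply: RD => //; apply: Rsym.
Qed.

Theorem theorem5p10 (f : int -> int) :
  congruence_preserving f <->
  (forall L : set int, recognizable L ->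
     forall Z : set int, generated_lattice L Z -> generated_lattice L (f @^-1` Z)).
Proof.
split=> [fP L recL Z LZ|fP R congR x y Rxy].
  have [LU LI _] := generated_lattice_translation L.
  (* Quantifying over all shifts [a] makes the property stable under translation; the base case
     holds because [f] plus a constant is still congruence preserving. *)
  suff /(_ Z LZ 0) : generated_lattice L `<=`
      [set Y | forall a, generated_lattice L [set x | Y (f x + a)]].
    by under eq_set do rewrite addr0.
  apply: generated_lattice_ind => [|a].
    split=> [Y Y' HY HY' a|Y Y' HY HY' a|b Y HY a].
    - exact: LU (HY a) (HY' a).
    - exact: LI (HY a) (HY' a).
    - by have := HY (a + b); under eq_set do rewrite addrA.
  apply: (generated_lattice_preimage (f := fun x => f x + a)) => // R congR x y Rxy.
  have [[Rrefl _ _] RD] := congR.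
  by apply: RD; [apply: fP | apply: Rrefl].
have [[Rrefl Rsym Rtrans] RD] := congR.
have [->|neq_xy] := pselect (x = y); first exact: Rrefl.
have recL := congruence_class_recognizable (f x) congR Rxy neq_xy.
have := fP _ recL _ (@generated_lattice_gen _).
have sat : generated_lattice [set z | R z (f x)] `<=`
    [set Y | forall u v, R u v -> Y u -> Y v].
  apply: generated_lattice_ind => [|u v /= Ruv Ru].
    split=> [Y Y' HY HY' u v Ruv|Y Y' HY HY' u v Ruv|b Y HY u v Ruv] /=.
    - by case=> [/(HY _ _ Ruv)|/(HY' _ _ Ruv)]; [left|right].
    - by case=> /(HY _ _ Ruv) ? /(HY' _ _ Ruv).
    - by apply: HY; apply: RD => //; apply: Rrefl.
  by apply: Rtrans Ru; apply: Rsym.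
(* The preimage of the class of [f x] contains [x] and is saturated, so it contains [y]. *)
by move=> /sat/(_ x y Rxy (Rrefl _)) => /Rsym.
Qed.
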